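(* Let $(A_i)_{i\in I}$ be a non-empty family of residuated lattices and let $A=\prod _{i\in I}A_i$ with componentwise operations. If $A$ has the Boolean Lifting Property (BLP), then, for every $i\in I$, $A_i$ has BLP.
   Context: A residuated lattice is a commutative integral bounded one: a structure $(A,\vee ,\wedge ,\odot ,\rightarrow ,0,1)$ such that $(A,\vee ,\wedge ,0,1)$ is a bounded lattice, $(A,\odot ,1)$ is a commutative monoid, and $a\leq b\rightarrow c$ iff $a\odot b\leq c$ for all $a,b,c$. Write $a\leftrightarrow b=(a\rightarrow b)\wedge (b\rightarrow a)$. $\mathcal{B}(A)$ is the set of complemented elements of the bounded lattice reduct of $A$. A filter of $A$ is a nonempty subset closed under $\odot$ and upward closed. For a filter $F$, $A/F$ is the quotient residuated lattice by the congruence $a\equiv b$ iff $a\leftrightarrow b\in F$, with classes $a/F$. $F$ has BLP iff for every $f\in \mathcal{B}(A/F)$ there is $e\in \mathcal{B}(A)$ with $e/F=f$. $A$ has BLP iff all its filters have BLP. *)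

(* Defs.v *)
From HB Require Import structures.
From mathcomp Require Import all_boot all_order.
From mathcomp Require Import boolp.

Set Implicit Arguments.
Unset Strict Implicit.
Unset Printing Implicit Defensive.

Import Order.LTheory.
Local Open Scope order_scope.
Local Open Scope quotient_scope.

(* The trivial algebra, with \bot = \top, is allowed. *)
HB.mixin Record TBLattice_isResiduated (d : Order.disp_t) A
    of Order.TBLattice d A := {
  rmul : A -> A -> A;
  rimp : A -> A -> A;
  rmulA : associative rmul;
  rmulC : commutative rmul;
  rmul1x : left_id (\top : A) rmul;
  residuation : forall a b c : A, (a <= rimp b c) = (rmul a b <= c);
}.

#[short(type="residLatticeType")]
HB.structure Definition ResidLattice (d : Order.disp_t) :=
  { A of Order.TBLattice d A & TBLattice_isResiduated d A }.

Notation "a ⊙ b" := (rmul a b)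
  (at level 40, left associativity) : order_scope.
Notation "a ⇒ b" := (rimp a b)
  (at level 55, right associativity) : order_scope.

Section Basics.
Context {d : Order.disp_t} {A : residLatticeType d}.
Implicit Types a b c : A.

Definition riff a b : A := (a ⇒ b) `&` (b ⇒ a).

Lemma rmulx1 a : a ⊙ \top = a.
Proof. by rewrite rmulC rmul1x. Qed.

Lemma rimp_rmul_le a b : (a ⇒ b) ⊙ a <= b.
Proof. by rewrite -residuation. Qed.

Lemma ler_rmul a b a' b' : a <= a' -> b <= b' -> a ⊙ b <= a' ⊙ b'.
Proof.
have mono x y z : x <= y -> x ⊙ z <= y ⊙ z.
  by move=> xy; rewrite -residuation (le_trans xy)// residuation.
move=> aa' bb'; apply: (@le_trans _ _ (a' ⊙ b)); first exact: mono.
by rewrite rmulC [_ ⊙ b']rmulC; apply: mono.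
Qed.

Lemma rmul_lel a b : a ⊙ b <= a.
Proof. by rewrite -[leRHS]rmulx1; apply: ler_rmul; rewrite ?lex1. Qed.

Lemma rmul_ler a b : a ⊙ b <= b.
Proof. by rewrite rmulC rmul_lel. Qed.

Lemma rmul_le_meet a b : a ⊙ b <= a `&` b.
Proof. by rewrite lexI rmul_lel rmul_ler. Qed.

Lemma rimp_rmul a b c : (a ⊙ b) ⇒ c = a ⇒ (b ⇒ c).
Proof.
by apply: le_anti; rewrite !residuation -rmulA -residuation lexx rmulA
  -!residuation lexx.
Qed.

Lemma le_rimp a b : a <= b -> a ⇒ b = \top.
Proof. by move=> ab; apply: le_anti; rewrite lex1 residuation rmul1x ab. Qed.

End Basics.

(* Proper and improper filters alike. *)
Record rfilter (d : Order.disp_t) (A : residLatticeType d) := RFilter {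
  filter_set :> A -> Prop;
  filter_nonempty : exists a, filter_set a;
  filter_mul : forall a b, filter_set a -> filter_set b -> filter_set (a ⊙ b);
  filter_up : forall a b, a <= b -> filter_set a -> filter_set b;
}.

Section FilterCongruence.
Context {d : Order.disp_t} {A : residLatticeType d} (F : rfilter A).
Implicit Types a b c : A.

Definition filter_eq a b : bool := `[< F (riff a b) >].

(* The preorder on A inducing the order of A/F. *)
Definition filter_le a b : bool := `[< F (a ⇒ b) >].

Lemma filter_top : F \top.
Proof. by have [a Fa] := filter_nonempty F; apply: filter_up Fa; exact: lex1. Qed.

Lemma filter_meet a b : F (a `&` b) <-> F a /\ F b.
Proof.
split=> [Fab|[Fa Fb]].
  by split; apply: filter_up Fab; rewrite ?leIl ?leIr.
by apply: filter_up (filter_mul Fa Fb); exact: rmul_le_meet.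
Qed.

Lemma filter_eqE a b : filter_eq a b = filter_le a b && filter_le b a.
Proof.
apply/asboolP/andP => [/filter_meet[ab ba]|[/asboolP ab /asboolP ba]].
  by split; apply/asboolP.
exact/filter_meet.
Qed.

Lemma le_filter_le a b : a <= b -> filter_le a b.
Proof. by move=> ab; apply/asboolP; rewrite le_rimp//; exact: filter_top. Qed.

Lemma filter_le_refl : reflexive filter_le.
Proof. by move=> a; apply: le_filter_le. Qed.

Lemma filter_le_trans : transitive filter_le.
Proof.
move=> b a c /asboolP ab /asboolP bc; apply/asboolP.
apply: filter_up (filter_mul bc ab); rewrite residuation -rmulA.
by apply: le_trans (rimp_rmul_le b c); apply: ler_rmul => //; exact: rimp_rmul_le.
Qed.

Lemma filter_leI a b c :
  filter_le a (b `&` c) = filter_le a b && filter_le a c.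
Proof.
apply/idP/andP => [h|[/asboolP ab /asboolP ac]].
  by split; apply: filter_le_trans h _; apply: le_filter_le; rewrite ?leIl ?leIr.
apply/asboolP; apply: filter_up (filter_mul ab ac).
rewrite residuation lexI; apply/andP; split.
  by apply: le_trans (rimp_rmul_le a b); apply: ler_rmul => //; exact: rmul_lel.
by apply: le_trans (rimp_rmul_le a c); apply: ler_rmul => //; exact: rmul_ler.
Qed.

Lemma filter_leU a b c :
  filter_le (a `|` b) c = filter_le a c && filter_le b c.
Proof.
apply/idP/andP => [h|[/asboolP ac /asboolP bc]].
  by split; apply: filter_le_trans h; apply: le_filter_le; rewrite ?leUl ?leUr.
apply/asboolP; apply: filter_up (filter_mul ac bc).
rewrite residuation rmulC -residuation leUx !residuation; apply/andP; split.
  rewrite rmulC; apply: le_trans (rimp_rmul_le a c).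
  by apply: ler_rmul => //; exact: rmul_lel.
rewrite rmulC; apply: le_trans (rimp_rmul_le b c).
by apply: ler_rmul => //; exact: rmul_ler.
Qed.

Lemma filter_le_rimp a b c : filter_le a (b ⇒ c) = filter_le (a ⊙ b) c.
Proof. by rewrite /filter_le rimp_rmul. Qed.

Lemma filter_le_rmul a b a' b' :
  filter_le a a' -> filter_le b b' -> filter_le (a ⊙ b) (a' ⊙ b').
Proof.
have mono x y z : filter_le x y -> filter_le (x ⊙ z) (y ⊙ z).
  move=> xy; rewrite -filter_le_rimp; apply: (filter_le_trans xy).
  by rewrite filter_le_rimp filter_le_refl.
move=> aa' bb'; apply: (filter_le_trans (mono _ _ b aa')).
by rewrite rmulC [_ ⊙ b']rmulC; apply: mono.
Qed.

Lemma filter_le_imp a b a' b' :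
  filter_le a' a -> filter_le b b' -> filter_le (a ⇒ b) (a' ⇒ b').
Proof.
move=> aa' bb'; rewrite filter_le_rimp; apply: filter_le_trans bb'.
apply: filter_le_trans (le_filter_le (rimp_rmul_le a b)).
by apply: filter_le_rmul => //; exact: filter_le_refl.
Qed.

Lemma filter_le_meet a b a' b' :
  filter_le a a' -> filter_le b b' -> filter_le (a `&` b) (a' `&` b').
Proof.
move=> aa' bb'; rewrite filter_leI; apply/andP; split.
  by apply: filter_le_trans aa'; apply: le_filter_le; exact: leIl.
by apply: filter_le_trans bb'; apply: le_filter_le; exact: leIr.
Qed.

Lemma filter_le_join a b a' b' :
  filter_le a a' -> filter_le b b' -> filter_le (a `|` b) (a' `|` b').
Proof.
move=> aa' bb'; rewrite filter_leU; apply/andP; split.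
  by apply: (filter_le_trans aa'); apply: le_filter_le; exact: leUl.
by apply: (filter_le_trans bb'); apply: le_filter_le; exact: leUr.
Qed.

Lemma filter_eq_refl : reflexive filter_eq.
Proof. by move=> a; rewrite filter_eqE filter_le_refl. Qed.

Lemma filter_eq_sym : symmetric filter_eq.
Proof. by move=> a b; rewrite !filter_eqE andbC. Qed.

Lemma filter_eq_trans : transitive filter_eq.
Proof.
move=> b a c; rewrite !filter_eqE => /andP[ab ba] /andP[bc cb].
by rewrite (filter_le_trans ab bc) (filter_le_trans cb ba).
Qed.

Canonical filter_equiv :=
  EquivRel filter_eq filter_eq_refl filter_eq_sym filter_eq_trans.

End FilterCongruence.

(* A/F, with class map a |-> \pi_(rquot F) a. *)
Definition rquot (d : Order.disp_t) (A : residLatticeType d) (F : rfilter A) :=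
  {eq_quot (filter_equiv F)}.

HB.instance Definition _ d (A : residLatticeType d) (F : rfilter A) :=
  EqQuotient.on (rquot F).
HB.instance Definition _ d (A : residLatticeType d) (F : rfilter A) :=
  Choice.on (rquot F).

Section Quotient.
Context {d : Order.disp_t} {A : residLatticeType d} (F : rfilter A).
Local Notation Q := (rquot F).
Implicit Types x y z : Q.

Lemma rquot_eqP (a b : A) : \pi_Q a = \pi_Q b <-> F (riff a b).
Proof.
split=> [/eqP|h]; first by rewrite eqmodE => /asboolP.
by apply/eqP; rewrite eqmodE; apply/asboolP.
Qed.

Lemma repr_pi_le (a : A) :
  filter_le F (repr (\pi_Q a)) a /\ filter_le F a (repr (\pi_Q a)).
Proof.
apply/andP; rewrite -filter_eqE; apply/asboolP.
by apply/rquot_eqP; rewrite reprK.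
Qed.

Definition rquot_le x y : bool := filter_le F (repr x) (repr y).
Definition rquot_meet x y : Q := \pi_Q (repr x `&` repr y).
Definition rquot_join x y : Q := \pi_Q (repr x `|` repr y).
Definition rquot_mul x y : Q := \pi_Q (repr x ⊙ repr y).
Definition rquot_imp x y : Q := \pi_Q (repr x ⇒ repr y).

Lemma filter_le_reprl (a b : A) :
  filter_le F (repr (\pi_Q a)) b = filter_le F a b.
Proof.
by have [h1 h2] := repr_pi_le a; apply/idP/idP; apply: filter_le_trans.
Qed.

Lemma filter_le_reprr (a b : A) :
  filter_le F a (repr (\pi_Q b)) = filter_le F a b.
Proof.
have [h1 h2] := repr_pi_le b.
by apply/idP/idP => h; [apply: filter_le_trans h h1|apply: filter_le_trans h h2].
Qed.

Fact rquot_le_refl : reflexive rquot_le.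
Proof. by move=> x; apply: filter_le_refl. Qed.

Fact rquot_le_anti : antisymmetric rquot_le.
Proof.
move=> x y; rewrite -(reprK x) -(reprK y) /rquot_le.
rewrite !filter_le_reprl !filter_le_reprr -filter_eqE => /asboolP h.
exact/rquot_eqP.
Qed.

Fact rquot_le_trans : transitive rquot_le.
Proof. by move=> y x z; apply: filter_le_trans. Qed.

HB.instance Definition _ := Order.Le_isPOrder.Build d Q
  rquot_le_refl rquot_le_anti rquot_le_trans.

Fact rquot_meetP x y z : (x <= rquot_meet y z) = (x <= y) && (x <= z).
Proof. by rewrite /Order.le /= /rquot_le filter_le_reprr filter_leI. Qed.

Fact rquot_joinP x y z : (rquot_join x y <= z) = (x <= z) && (y <= z).
Proof. by rewrite /Order.le /= /rquot_le filter_le_reprl filter_leU. Qed.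

HB.instance Definition _ := Order.POrder_MeetJoin_isLattice.Build d Q
  rquot_meetP rquot_joinP.

Fact rquot_le0x x : \pi_Q \bot <= x.
Proof.
by rewrite /Order.le /= /rquot_le filter_le_reprl le_filter_le// le0x.
Qed.

Fact rquot_lex1 x : x <= \pi_Q \top.
Proof.
by rewrite /Order.le /= /rquot_le filter_le_reprr le_filter_le// lex1.
Qed.

HB.instance Definition _ := Order.hasBottom.Build d Q rquot_le0x.
HB.instance Definition _ := Order.hasTop.Build d Q rquot_lex1.

Lemma pi_rquot_le (a b : A) : (\pi_Q a <= \pi_Q b) = `[< F (a ⇒ b) >].
Proof. by rewrite /Order.le /= /rquot_le filter_le_reprl filter_le_reprr. Qed.

Lemma pi_rquot_bot : \pi_Q \bot = \bot. Proof. by []. Qed.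
Lemma pi_rquot_top : \pi_Q \top = \top. Proof. by []. Qed.

Fact rquot_eq_le (a b : A) :
  filter_le F a b -> filter_le F b a -> \pi_Q a = \pi_Q b.
Proof.
move=> ab ba; apply/rquot_eqP/asboolP.
by rewrite -/(filter_eq F a b) filter_eqE ab.
Qed.

Lemma pi_rquot_meet (a b : A) : \pi_Q (a `&` b) = \pi_Q a `&` \pi_Q b.
Proof.
have [? ?] := repr_pi_le a; have [? ?] := repr_pi_le b.
by apply: rquot_eq_le; apply: filter_le_meet.
Qed.

Lemma pi_rquot_join (a b : A) : \pi_Q (a `|` b) = \pi_Q a `|` \pi_Q b.
Proof.
have [? ?] := repr_pi_le a; have [? ?] := repr_pi_le b.
by apply: rquot_eq_le; apply: filter_le_join.
Qed.

Fact pi_rquot_mul_subproof (a b : A) :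
  \pi_Q (a ⊙ b) = rquot_mul (\pi_Q a) (\pi_Q b).
Proof.
have [? ?] := repr_pi_le a; have [? ?] := repr_pi_le b.
by apply: rquot_eq_le; apply: filter_le_rmul.
Qed.

Fact pi_rquot_imp_subproof (a b : A) :
  \pi_Q (a ⇒ b) = rquot_imp (\pi_Q a) (\pi_Q b).
Proof.
have [? ?] := repr_pi_le a; have [? ?] := repr_pi_le b.
by apply: rquot_eq_le; apply: filter_le_imp.
Qed.

Fact rquot_mulA : associative rquot_mul.
Proof.
elim/quotW=> x; elim/quotW=> y; elim/quotW=> z.
rewrite -(pi_rquot_mul_subproof y z) -(pi_rquot_mul_subproof x y).
by rewrite -(pi_rquot_mul_subproof x) -(pi_rquot_mul_subproof (x ⊙ y)) rmulA.
Qed.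

Fact rquot_mulC : commutative rquot_mul.
Proof. by move=> x y; rewrite /rquot_mul rmulC. Qed.

Fact rquot_mul1x : left_id (\top : Q) rquot_mul.
Proof.
by move=> x; rewrite -(reprK x) -pi_rquot_top -pi_rquot_mul_subproof rmul1x.
Qed.

Fact rquot_residuation x y z :
  (x <= rquot_imp y z) = (rquot_mul x y <= z).
Proof.
by rewrite /Order.le /= /rquot_le filter_le_reprr filter_le_reprl
  filter_le_rimp.
Qed.

HB.instance Definition _ := TBLattice_isResiduated.Build d Q
  rquot_mulA rquot_mulC rquot_mul1x rquot_residuation.

Lemma pi_rquot_mul (a b : A) : \pi_Q (a ⊙ b) = \pi_Q a ⊙ \pi_Q b.
Proof. exact: pi_rquot_mul_subproof. Qed.

Lemma pi_rquot_imp (a b : A) : \pi_Q (a ⇒ b) = \pi_Q a ⇒ \pi_Q b.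
Proof. exact: pi_rquot_imp_subproof. Qed.

End Quotient.

Definition rprod (d : Order.disp_t) (I : Type) (A : I -> residLatticeType d) :=
  forall i, A i.

HB.instance Definition _ d I (A : I -> residLatticeType d) :=
  gen_eqMixin (rprod A).
HB.instance Definition _ d I (A : I -> residLatticeType d) :=
  gen_choiceMixin (rprod A).

Section Product.
Context {d : Order.disp_t} {I : Type} (A : I -> residLatticeType d).
Local Notation P := (rprod A).
Implicit Types f g h : P.

Definition rprod_le f g : bool := `[< forall i, f i <= g i >].

Fact rprod_le_refl : reflexive rprod_le.
Proof. by move=> f; apply/asboolP. Qed.

Fact rprod_le_anti : antisymmetric rprod_le.
Proof.
move=> f g /andP[/asboolP fg /asboolP gf]; apply: functional_extensionality_dep.
by move=> i; apply: le_anti; rewrite fg gf.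
Qed.

Fact rprod_le_trans : transitive rprod_le.
Proof.
move=> g f h /asboolP fg /asboolP gh; apply/asboolP => i.
exact: le_trans (fg i) (gh i).
Qed.

HB.instance Definition _ := Order.Le_isPOrder.Build d P
  rprod_le_refl rprod_le_anti rprod_le_trans.

Lemma rprod_leP f g : reflect (forall i, f i <= g i) (f <= g).
Proof. exact: asboolP. Qed.

Fact rprod_meetP f g h :
  (f <= (fun i => g i `&` h i) :> P) = (f <= g) && (f <= h).
Proof.
apply/rprod_leP/andP => [le|[/rprod_leP fg /rprod_leP fh] i].
  by split; apply/rprod_leP => i; move: (le i); rewrite lexI => /andP[].
by rewrite lexI fg fh.
Qed.

Fact rprod_joinP f g h :
  ((fun i => f i `|` g i) <= h :> P) = (f <= h) && (g <= h).
Proof.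
apply/rprod_leP/andP => [le|[/rprod_leP fh /rprod_leP gh] i].
  by split; apply/rprod_leP => i; move: (le i); rewrite leUx => /andP[].
by rewrite leUx fh gh.
Qed.

HB.instance Definition _ := Order.POrder_MeetJoin_isLattice.Build d P
  rprod_meetP rprod_joinP.

Fact rprod_le0x f : ((fun i => \bot) : P) <= f.
Proof. by apply/rprod_leP => i; exact: le0x. Qed.

Fact rprod_lex1 f : f <= ((fun i => \top) : P).
Proof. by apply/rprod_leP => i; exact: lex1. Qed.

HB.instance Definition _ := Order.hasBottom.Build d P rprod_le0x.
HB.instance Definition _ := Order.hasTop.Build d P rprod_lex1.

Definition rprod_mul f g : P := fun i => f i ⊙ g i.
Definition rprod_imp f g : P := fun i => f i ⇒ g i.

Fact rprod_mulA : associative rprod_mul.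
Proof.
by move=> f g h; apply: functional_extensionality_dep => i; exact: rmulA.
Qed.

Fact rprod_mulC : commutative rprod_mul.
Proof.
by move=> f g; apply: functional_extensionality_dep => i; exact: rmulC.
Qed.

Fact rprod_mul1x : left_id (\top : P) rprod_mul.
Proof.
by move=> f; apply: functional_extensionality_dep => i; exact: rmul1x.
Qed.

Fact rprod_residuation f g h :
  (f <= rprod_imp g h) = (rprod_mul f g <= h).
Proof.
by apply/rprod_leP/rprod_leP => le i; move: (le i); rewrite residuation.
Qed.

HB.instance Definition _ := TBLattice_isResiduated.Build d P
  rprod_mulA rprod_mulC rprod_mul1x rprod_residuation.

Lemma rprod_meetE f g i : (f `&` g) i = f i `&` g i. Proof. by []. Qed.
Lemma rprod_joinE f g i : (f `|` g) i = f i `|` g i. Proof. by []. Qed.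
Lemma rprod_mulE f g i : (f ⊙ g) i = f i ⊙ g i. Proof. by []. Qed.
Lemma rprod_impE f g i : (f ⇒ g) i = f i ⇒ g i. Proof. by []. Qed.
Lemma rprod_botE i : (\bot : P) i = \bot. Proof. by []. Qed.
Lemma rprod_topE i : (\top : P) i = \top. Proof. by []. Qed.

End Product.

Definition complemented (d : Order.disp_t) (L : tbLatticeType d)
    (a : L) : Prop :=
  exists b : L, a `|` b = \top /\ a `&` b = \bot.

Definition filter_BLP (d : Order.disp_t) (A : residLatticeType d)
    (F : rfilter A) : Prop :=
  forall f : rquot F, complemented f ->
  exists e : A, complemented e /\ \pi_(rquot F) e = f.

Definition BLP (d : Order.disp_t) (A : residLatticeType d) : Prop :=
  forall F : rfilter A, filter_BLP F.

(* Main.v *)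
Require Import Defs.
From mathcomp Require Import all_boot all_order.
From mathcomp Require Import boolp.

Set Implicit Arguments.
Unset Strict Implicit.
Unset Printing Implicit Defensive.

Import Order.LTheory.
Local Open Scope order_scope.
Local Open Scope quotient_scope.

(** The coordinate projection of the product [rprod A] onto [A i] is a
surjective morphism of residuated lattices. Hence a filter [F] of [A i] pulls
back to a filter [G] of the product, and two elements of the product have the
same class modulo [G] exactly when their [i]-th coordinates have the same class
modulo [F] ([coord_filter_piP]). Thus the projection induces an isomorphism of
the quotient by [G] onto the quotient by [F]. A complemented class modulo [F]
thus gives a complemented class modulo [G]; BLP of the product lifts it to a
complemented element [e], and the coordinate [e i] is complemented in [A i] and
lifts the initial class. *)

(** Surjectivity of the coordinate projections. *)
Lemma rprod_coord_surj (d : Order.disp_t) (I : Type)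
    (A : I -> residLatticeType d) (i : I) (a : A i) :
  exists g : rprod A, g i = a.
Proof.
exists (fun j => if pselect (i = j) is left e then ecast j (A j) e a else \bot).
by case: pselect => // e; rewrite (Prop_irrelevance e erefl).
Qed.

Lemma complemented_coord (d : Order.disp_t) (I : Type)
    (A : I -> residLatticeType d) (e : rprod A) (i : I) :
  complemented e -> complemented (e i).
Proof.
case=> e' [join_e meet_e]; exists (e' i).
by rewrite -rprod_joinE join_e -rprod_meetE meet_e.
Qed.

Section CoordFilter.
Context {d : Order.disp_t} {I : Type} {A : I -> residLatticeType d}.
Context (i : I) (F : rfilter (A i)).

(** The inverse image of [F] under the projection onto the [i]-th factor. *)
Definition coord_filter : rfilter (rprod A).
Proof.
exists (fun g => F (g i)).
- by exists \top; exact: filter_top.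
- by move=> g h; exact: filter_mul.
- by move=> g h /rprod_leP/(_ i); exact: filter_up.
Defined.

Lemma coord_filter_piP (g h : rprod A) :
  \pi_(rquot coord_filter) g = \pi_(rquot coord_filter) h <->
  \pi_(rquot F) (g i) = \pi_(rquot F) (h i).
Proof. by rewrite !rquot_eqP. Qed.

Lemma complemented_coord_filter (g : rprod A) :
  complemented (\pi_(rquot F) (g i)) ->
  complemented (\pi_(rquot coord_filter) g).
Proof.
case; elim/quotW=> b; have [h <-] := rprod_coord_surj b.
rewrite -pi_rquot_join -pi_rquot_meet -pi_rquot_top -pi_rquot_bot => -[gh1 gh0].
exists (\pi_(rquot coord_filter) h); rewrite -pi_rquot_join -pi_rquot_meet.
by split; exact/coord_filter_piP.
Qed.

Lemma coord_filter_BLP : filter_BLP coord_filter -> filter_BLP F.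
Proof.
move=> GBLP; elim/quotW=> a; have [g <-] := rprod_coord_surj a.
move=> /complemented_coord_filter/GBLP[e [e_compl /coord_filter_piP e_lifts]].
by exists (e i); split=> //; exact: complemented_coord.
Qed.

End CoordFilter.

Theorem proposition5p6 (d : Order.disp_t) (I : Type)
    (A : I -> residLatticeType d) (I_nonempty : inhabited I)
    (A_BLP : BLP (rprod A)) :
  forall i : I, BLP (A i).
Proof. by move=> i F; apply: coord_filter_BLP; exact: A_BLP. Qed.
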